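(* Suppose that the control domain $U\subset\mathbb R$ is convex and that $b,\sigma,f,h$ satisfy assumptions (A1)–(A3) of the context. Let $a\ge0$, $T>0$, $x_0\in\mathbb R$ and $\bar u\in\mathcal U'_a[0,T]$. If for every $v\in\mathcal U'_a[0,T]$ one has $J^{(1)}(\bar u,v)=0$ and $J^{(2)}(\bar u,v)>0$, then $\bar u$ is a strict local optimal control for the problem of minimizing $J$ over $\mathcal U'_a[0,T]$, in the sense that for every $v\in\mathcal U'_a[0,T]\setminus\{0\}$ there is some $\varepsilon_0\in(0,1]$ so that $J(\bar u)<J(\bar u+\varepsilon v)$ for any $0<|\varepsilon|\le\varepsilon_0$.
   Context: Setting. $S$ is a subordinator with $S_0=0$, drift $\kappa>0$ and arbitrary Lévy measure ($S_t=\kappa t+S^0_t$, $S^0$ a driftless subordinator); $B$ is a standard one-dimensional Brownian motion with $B_0=0$ independent of $S$, on a probability space $(\Omega,\mathcal F,\mathbb P)$; $L_t=\inf\{r>0:S_r>t\}$. $\{\mathcal F'_t\}$ is the minimum augmented filtration generated by $t\mapsto B_{L_{(t-a)^+}}$. $U$ is a non-empty convex Borel subset of $\mathbb R$. $\mathcal U'_a[0,T]$ is the set of admissible controls, i.e. $\{\mathcal F'_t\}_{t\in[0,T]}$-progressively measurable $U$-valued processes $u$ with $\mathbb E\int_0^Tu(t)^2dt<\infty$. State and cost. For a control $u$, $x^u$ solves $dx^u(t)=b(t,x^u(t),u(t))dt+\sigma(t,x^u(t),u(t))dB_{L_{(t-a)^+}}$ on $[0,T]$, $x^u(0)=x_0$,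 and $J(u)=\mathbb E\big[\int_0^Tf(t,x^u(t),u(t))dt+h(x^u(T))\big]$. Assumptions, with a constant $\Lambda>0$: (A1) for $\varphi=b,\sigma,f:[0,T]\times\mathbb R\times U\to\mathbb R$: $|\varphi(t,x,u)-\varphi(t,y,v)|\le\Lambda(|x-y|+|u-v|)$ and $|\varphi(t,0,u)|\le\Lambda$. (A2) $b,\sigma,f$ are $C^2$ in $x$ and, for $\varphi=b,\sigma,f$, $|\varphi_x(t,x,u)-\varphi_x(t,y,v)|+|\varphi_{xx}(t,x,u)-\varphi_{xx}(t,y,v)|\le\Lambda(|x-y|+|u-v|)$. (A3) $h:\mathbb R\to\mathbb R$ is $C^2$ and $|h'(x)-h'(y)|+|h''(x)-h''(y)|\le\Lambda|x-y|$. First and second order variations of the cost: for $\varepsilon\in(0,1]$ put $J^{1,\varepsilon}(\bar u,v)=\varepsilon^{-1}\big(J(\bar u+\varepsilon v)-J(\bar u)\big)$, and $$J^{(1)}(\bar u,v)=\lim_{\varepsilon\to0}J^{1,\varepsilon}(\bar u,v),\qquad J^{(2)}(\bar u,v)=\lim_{\varepsilon\to0}\frac{J^{1,\varepsilon}(\bar u,v)-J^{(1)}(\bar u,v)}{\varepsilon}.$$ In the source, the existence of these limits is derived (not assumed) under the assumptions above, giving $J(\bar u+\varepsilon v)=J(\bar u)+\varepsilon J^{(1)}(\bar u,v)+\varepsilon^2J^{(2)}(\bar u,v)+o(\varepsilon^2)$.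
   Formalization: The conditions J1=0, J2>0 are required for all v not a.e. zero with v or -v admissible (one-sided limits say nothing about negative ε, and J2(ū,0)=0); ε ranges only over values with ū+εv admissible, and v≠0 is meant dt×dP-a.e. *)

(* Defs.v *)
From HB Require Import structures.
From mathcomp Require Import all_boot all_order all_algebra.
From mathcomp Require Import all_classical all_reals all_analysis.
Set Implicit Arguments.
Unset Strict Implicit.
Unset Printing Implicit Defensive.
Import Order.TTheory GRing.Theory Num.Theory.
Import numFieldNormedType.Exports.
Local Open Scope classical_set_scope.
Local Open Scope ring_scope.

(* A process is a function R -> Omega -> R of which only the times t >= 0 (or
   t in [0, T]) are ever used. *)

Definition history {Omega : Type} {R : realType} (X : R -> Omega -> R) (t : R) :
    set (set Omega) :=
  [set E | exists s (A : set R),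
     [/\ 0 <= s, s <= t, measurable A & E = X s @^-1` A]].

Definition full_history {Omega : Type} {R : realType} (X : R -> Omega -> R) :
    set (set Omega) :=
  [set E | exists t, 0 <= t /\ history X t E].

(* Generators of the filtration of X augmented by the P-null events. *)
Definition augmented {d : measure_display} {Omega : measurableType d}
    {R : realType} (P : probability Omega R) (X : R -> Omega -> R) (t : R) :
    set (set Omega) :=
  history X t `|` [set N | measurable N /\ P N = 0%E].

Definition adapted {d : measure_display} {Omega : measurableType d}
    {R : realType} (G : R -> set (set Omega)) (T : R) (X : R -> Omega -> R) :
    Prop :=
  forall t, 0 <= t <= T ->
    measurable_fun setT (X t : g_sigma_algebraType (G t) -> R).

Definition progressively_measurable {d : measure_display}
    {Omega : measurableType d} {R : realType} (G : R -> set (set Omega))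
    (T : R) (X : R -> Omega -> R) : Prop :=
  forall t, 0 <= t <= T ->
    measurable_fun (`[0, t] `*` setT)
      (fun z : R * g_sigma_algebraType (G t) => X z.1 z.2).

Definition independent_of {d : measure_display} {Omega : measurableType d}
    {R : realType} (P : probability Omega R) (G1 G2 : set (set Omega)) : Prop :=
  forall E F, <<s G1 >> E -> <<s G2 >> F -> P (E `&` F) = (P E * P F)%E.

Definition increment {Omega : Type} {R : realType} (X : R -> Omega -> R)
    (s t : R) : Omega -> R := fun w => X t w - X s w.

Definition independent_increments {d : measure_display}
    {Omega : measurableType d} {R : realType} (P : probability Omega R)
    (X : R -> Omega -> R) : Prop :=
  forall s t, 0 <= s <= t ->
    independent_of P (history X s)
      [set increment X s t @^-1` A | A in [set A : set R | measurable A]].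

Definition brownian_motion {d : measure_display} {Omega : measurableType d}
    {R : realType} (P : probability Omega R) (B : R -> Omega -> R) : Prop :=
  [/\ forall t, 0 <= t -> measurable_fun setT (B t),
      forall w, B 0 w = 0,
      forall w, {within `[0, +oo[, continuous (fun t => B t w)},
      independent_increments P B &
      forall s t (A : set R), 0 <= s -> s < t -> measurable A ->
        P (increment B s t @^-1` A) = normal_prob 0 (Num.sqrt (t - s)) A].

(* Levy measures of subordinators. *)
Definition levy_measure {R : realType} (nu : {measure set R -> \bar R}) :
    Prop :=
  nu (`]-oo, 0]%classic) = 0%E /\
  (\int[nu]_(y in `]0%R, +oo[) (Num.min 1 y)%:E < +oo)%E.

Definition laplace_exponent {R : realType} (nu : {measure set R -> \bar R})
    (lam : R) : R :=
  fine (\int[nu]_(y in `]0%R, +oo[) (1 - expR (- lam * y))%:E)%E.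

Definition driftless_subordinator {d : measure_display}
    {Omega : measurableType d} {R : realType} (P : probability Omega R)
    (S0 : R -> Omega -> R) : Prop :=
  [/\ forall t, 0 <= t -> measurable_fun setT (S0 t),
      forall w, S0 0 w = 0,
      forall w t, 0 <= t ->
        (forall r, t <= r -> S0 t w <= S0 r w) /\
        S0 r w @[r --> t^'+] --> S0 t w,
      independent_increments P S0 &
      (forall s t (A : set R), 0 <= s -> 0 <= t -> measurable A ->
        P (increment S0 s (s + t) @^-1` A) = P (S0 t @^-1` A)) /\
      exists nu : {measure set R -> \bar R}, levy_measure nu /\
        forall t lam, 0 <= t -> 0 < lam ->
          ('E_P[fun w => expR (- lam * S0 t w)] =
             (expR (- t * laplace_exponent nu lam))%:E)%E].

Definition subordinator {d : measure_display} {Omega : measurableType d}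
    {R : realType} (P : probability Omega R) (kappa : R)
    (S : R -> Omega -> R) : Prop :=
  exists S0, driftless_subordinator P S0 /\
    forall t w, 0 <= t -> S t w = kappa * t + S0 t w.

Definition inverse_subordinator {Omega : Type} {R : realType}
    (S : R -> Omega -> R) (t : R) (w : Omega) : R :=
  inf [set r | 0 < r /\ t < S r w].

(* t |-> B_{L_{(t-a)^+}} *)
Definition delayed_bm {Omega : Type} {R : realType} (S B : R -> Omega -> R)
    (a : R) (t : R) (w : Omega) : R :=
  B (inverse_subordinator S (Num.max (t - a) 0) w) w.

Definition delayed_filtration {d : measure_display} {Omega : measurableType d}
    {R : realType} (P : probability Omega R) (S B : R -> Omega -> R) (a : R) :
    R -> set (set Omega) :=
  augmented P (delayed_bm S B a).

(* sum_(i < sp_size) sp_val i * 1_{]sp_time i, sp_time i.+1]} *)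
Record simple_process {Omega : Type} {R : realType} := SimpleProcess {
  sp_size : nat ;
  sp_time : nat -> R ;
  sp_val : nat -> Omega -> R }.
Arguments simple_process : clear implicits.

Definition simple_adapted {d : measure_display} {Omega : measurableType d}
    {R : realType} (G : R -> set (set Omega)) (T : R)
    (H : simple_process Omega R) : Prop :=
  [/\ 0 <= sp_time H 0%N, sp_time H (sp_size H) <= T &
      forall i, (i < sp_size H)%N ->
        [/\ sp_time H i <= sp_time H i.+1,
            measurable_fun setT
              (sp_val H i : g_sigma_algebraType (G (sp_time H i)) -> R) &
            exists M, forall w, `|sp_val H i w| <= M]].

Definition simple_eval {Omega : Type} {R : realType}
    (H : simple_process Omega R) (t : R) (w : Omega) : R :=
  \sum_(i < sp_size H | sp_time H i < t <= sp_time H i.+1) sp_val H i w.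

Definition simple_integral {Omega : Type} {R : realType}
    (H : simple_process Omega R) (Y : R -> Omega -> R) (t : R) (w : Omega) : R :=
  \sum_(i < sp_size H) sp_val H i w *
    (Y (Num.min t (sp_time H i.+1)) w - Y (Num.min t (sp_time H i)) w).

(* Expected value of int_0^T H(t)^2 d<Y>_t for Y = delayed_bm S B a.  The
   bracket of Y is t |-> L_{(t-a)^+}, whose Stieltjes measure on [0, T] is the
   image of Lebesgue measure on {r >= 0 | a + S_r <= T} under r |-> a + S_r. *)
Definition bracket_sqnorm {d : measure_display} {Omega : measurableType d}
    {R : realType} (P : probability Omega R) (S : R -> Omega -> R) (a T : R)
    (H : R -> Omega -> R) : \bar R :=
  (\int[P]_w \int[lebesgue_measure]_(r in [set r | (0 <= r)%R /\
      (a + S r w <= T)%R]) ((H (a + S r w)%R w) ^+ 2)%:E)%E.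

(* I is the Ito integral int_0^. H dY on [0, T], Y = delayed_bm S B a: the
   limit in mean square of the integrals of simple adapted processes converging
   to H in L^2(d<Y> x dP). *)
Definition ito_integral {d : measure_display} {Omega : measurableType d}
    {R : realType} (P : probability Omega R) (S B : R -> Omega -> R) (a T : R)
    (H I : R -> Omega -> R) : Prop :=
  [/\ progressively_measurable (delayed_filtration P S B a) T H,
      adapted (delayed_filtration P S B a) T I,
      {ae P, forall w, {within `[0, T], continuous (fun t => I t w)}} &
      exists Hn : nat -> simple_process Omega R,
        [/\ forall n, simple_adapted (delayed_filtration P S B a) T (Hn n),
            bracket_sqnorm P S a T (fun t w => simple_eval (Hn n) t w - H t w)
              @[n --> \oo] --> 0%E &
            forall t, 0 <= t <= T ->
              (\int[P]_w ((simple_integral (Hn n) (delayed_bm S B a) t w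
                             - I t w) ^+ 2)%:E)%E @[n --> \oo] --> 0%E]].

(* Squared norm of L^2(dt x dP) on [0, T] x Omega, the space in which controls
   are identified: it vanishes iff u = 0 dt x dP-almost everywhere. *)
Definition time_sqnorm {d : measure_display} {Omega : measurableType d}
    {R : realType} (P : probability Omega R) (T : R) (u : R -> Omega -> R) :
    \bar R :=
  (\int[P]_w \int[lebesgue_measure]_(t in `[0%R, T]) ((u t w) ^+ 2)%:E)%E.

Definition admissible {d : measure_display} {Omega : measurableType d}
    {R : realType} (P : probability Omega R) (S B : R -> Omega -> R) (a T : R)
    (U : set R) (u : R -> Omega -> R) : Prop :=
  [/\ progressively_measurable (delayed_filtration P S B a) T u,
      forall t w, 0 <= t <= T -> U (u t w) &
      (time_sqnorm P T u < +oo)%E].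

(* dx = b(t,x,u) dt + sigma(t,x,u) dB_{L_{(t-a)^+}} on [0, T], x(0) = x0 *)
Definition state_equation {d : measure_display} {Omega : measurableType d}
    {R : realType} (P : probability Omega R) (S B : R -> Omega -> R) (a T : R)
    (b sigma : R -> R -> R -> R) (x0 : R) (u x : R -> Omega -> R) : Prop :=
  [/\ adapted (delayed_filtration P S B a) T x,
      forall w, {within `[0, T], continuous (fun t => x t w)} &
      exists I : R -> Omega -> R,
        ito_integral P S B a T (fun t w => sigma t (x t w) (u t w)) I /\
        {ae P, forall w,
          lebesgue_measure.-integrable `[0, T]
            (EFin \o (fun s => b s (x s w) (u s w))) /\
          forall t, 0 <= t <= T ->
            x t w = x0 +
              \int[lebesgue_measure]_(s in `[0, t]) b s (x s w) (u s w) +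
              I t w}].

(* x maps each control u to the state process it drives. *)
Definition cost {d : measure_display} {Omega : measurableType d}
    {R : realType} (P : probability Omega R) (T : R) (f : R -> R -> R -> R)
    (h : R -> R) (x : (R -> Omega -> R) -> R -> Omega -> R)
    (u : R -> Omega -> R) : R :=
  fine ('E_P[fun w => (\int[lebesgue_measure]_(t in `[0, T])
                          f t (x u t w) (u t w) + h (x u T w))%R])%E.

(* The coefficients have domain [0, T] x R x U; their values for other
   arguments are irrelevant. *)
Definition lipschitz_bounded {R : realType} (T : R) (U : set R) (Lam : R)
    (phi : R -> R -> R -> R) : Prop :=
  forall t, 0 <= t <= T ->
    (forall x y u v, U u -> U v ->
       `|phi t x u - phi t y v| <= Lam * (`|x - y| + `|u - v|)) /\
    (forall u, U u -> `|phi t 0 u| <= Lam).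

Definition twice_continuously_derivable {R : realType} (g : R -> R) : Prop :=
  [/\ forall x, derivable g x 1, forall x, derivable g^`()%classic x 1 &
      continuous (g^`(2))%classic].

Definition smooth_in_state {R : realType} (T : R) (U : set R) (Lam : R)
    (phi : R -> R -> R -> R) : Prop :=
  forall t, 0 <= t <= T ->
    (forall u, U u -> twice_continuously_derivable (fun x => phi t x u)) /\
    (forall x y u v, U u -> U v ->
       `|(fun z => phi t z u)^`()%classic x - (fun z => phi t z v)^`()%classic y| +
       `|(fun z => phi t z u)^`(2)%classic x - (fun z => phi t z v)^`(2)%classic y|
         <= Lam * (`|x - y| + `|u - v|)).

Definition smooth_terminal_cost {R : realType} (Lam : R) (h : R -> R) : Prop :=
  twice_continuously_derivable h /\
  forall x y, `|h^`()%classic x - h^`()%classic y| +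
              `|h^`(2)%classic x - h^`(2)%classic y| <= Lam * `|x - y|.

Definition perturb {Omega : Type} {R : realType} (ubar : R -> Omega -> R)
    (eps : R) (v : R -> Omega -> R) : R -> Omega -> R :=
  fun t w => ubar t w + eps * v t w.

Definition cost_quotient {Omega : Type} {R : realType}
    (J : (R -> Omega -> R) -> R) (ubar v : R -> Omega -> R) (eps : R) : R :=
  eps^-1 * (J (perturb ubar eps v) - J ubar).

(* eps -> 0 through the eps in ]0, 1] for which ubar + eps v is a control, the
   only ones for which J (ubar + eps v) has a meaning. *)
Definition admissible_to0 {Omega : Type} {R : realType}
    (C : set (R -> Omega -> R)) (ubar v : R -> Omega -> R) : set_system R :=
  within [set eps | 0 < eps <= 1 /\ C (perturb ubar eps v)] (nbhs 0).

Definition first_variation {Omega : Type} {R : realType}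
    (C : set (R -> Omega -> R)) (J : (R -> Omega -> R) -> R)
    (ubar v : R -> Omega -> R) (j1 : R) : Prop :=
  cost_quotient J ubar v eps @[eps --> admissible_to0 C ubar v] --> j1.

Definition second_variation {Omega : Type} {R : realType}
    (C : set (R -> Omega -> R)) (J : (R -> Omega -> R) -> R)
    (ubar v : R -> Omega -> R) (j1 j2 : R) : Prop :=
  (cost_quotient J ubar v eps - j1) / eps
    @[eps --> admissible_to0 C ubar v] --> j2.

(* Main.v *)
(** Since J1 = 0, the difference J(ubar + eps v) - J(ubar) is eps^2 times a quotient tending to
    J2 > 0, so it is positive for small eps > 0.  The variations are one-sided limits; negative
    eps are reached through the direction -v, as ubar + eps v = ubar + (- eps) (- v). *)
Require Import Defs.
From HB Require Import structures.
From mathcomp Require Import all_boot all_order all_algebra.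
From mathcomp Require Import all_classical all_reals all_analysis.
Import Order.TTheory GRing.Theory Num.Theory.
Import numFieldNormedType.Exports.
Local Open Scope classical_set_scope.
Local Open Scope ring_scope.

(** The limit runs only through those [eps] in ]0, 1] with [ubar + eps v] in [C], so the conclusion
    is confined to them; if none lies near 0, a small [e] makes it vacuous. *)
Lemma second_variation_gt0_near (Omega : Type) (R : realType)
    (C : set (R -> Omega -> R)) (J : (R -> Omega -> R) -> R)
    (ubar v : R -> Omega -> R) (j2 : R) :
  second_variation C J ubar v 0 j2 -> 0 < j2 ->
  exists2 e : R, 0 < e & forall eps, 0 < eps <= 1 -> eps < e ->
    C (perturb ubar eps v) -> J ubar < J (perturb ubar eps v).
Proof.
move=> cv j2_gt0.
have /cv : nbhs j2 [set y : R | 0 < y] by exact: lt_nbhsr.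
rewrite /= /admissible_to0 => /nbhs_ballP[e /= e_gt0 He]; exists e => //.
move=> eps /andP[eps_gt0 eps_le1] eps_lt Ceps.
have : ball (0 : R) e eps by rewrite /ball /= sub0r normrN gtr0_norm.
move=> /He /(_ (conj _ Ceps)) /=.
rewrite eps_gt0 eps_le1 => /(_ isT).
(* With first variation 0, the quotient is the cost difference times two positive factors [eps^-1],
   so both have the same sign. *)
by rewrite subr0 /cost_quotient pmulr_lgt0 ?pmulr_rgt0 ?invr_gt0// subr_gt0.
Qed.

Lemma perturbN (Omega : Type) (R : realType) (ubar v : R -> Omega -> R)
    (eps : R) :
  perturb ubar (- eps) (fun t w => - v t w) = perturb ubar eps v.
Proof. by apply/funext => t; apply/funext => w; rewrite /perturb mulrNN. Qed.

(** Lets [- v] inherit from [v] the property of being nonzero as an element of L^2(dt x dP). *)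
Lemma time_sqnormN (d : measure_display) (Omega : measurableType d)
    (R : realType) (P : probability Omega R) (T : R) (v : R -> Omega -> R) :
  time_sqnorm P T (fun t w => - v t w) = time_sqnorm P T v.
Proof.
apply: eq_integral => w _; apply: eq_integral => t _.
by rewrite sqrrN.
Qed.

Theorem theorem6p4 (R : realType) (d : measure_display)
  (Omega : measurableType d) (P : probability Omega R)
  (S B : R -> Omega -> R) (kappa : R)
  (kappa_gt0 : 0 < kappa)
  (subS : subordinator P kappa S)
  (bmB : brownian_motion P B)
  (indepBS : independent_of P (full_history B) (full_history S))
  (U : set R) (U_neq0 : U !=set0) (mU : measurable U)
  (convexU : convex_set (U : set (convex_lmodType R^o)))
  (a T x0 Lam : R) (a_ge0 : 0 <= a) (T_gt0 : 0 < T) (Lam_gt0 : 0 < Lam)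
  (b sigma f : R -> R -> R -> R) (h : R -> R)
  (b_A1 : lipschitz_bounded T U Lam b)
  (sigma_A1 : lipschitz_bounded T U Lam sigma)
  (f_A1 : lipschitz_bounded T U Lam f)
  (b_A2 : smooth_in_state T U Lam b)
  (sigma_A2 : smooth_in_state T U Lam sigma)
  (f_A2 : smooth_in_state T U Lam f)
  (h_A3 : smooth_terminal_cost Lam h)
  (x : (R -> Omega -> R) -> R -> Omega -> R)
  (x_state : forall u, admissible P S B a T U u ->
     state_equation P S B a T b sigma x0 u (x u))
  (ubar : R -> Omega -> R)
  (ubar_adm : admissible P S B a T U ubar) :
  let C := admissible P S B a T U in
  let J := cost P T f h x in
  (forall v, C v \/ C (fun t w => - v t w) -> time_sqnorm P T v != 0%E ->
     exists j1 j2, [/\ first_variation C J ubar v j1,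
                       second_variation C J ubar v j1 j2,
                       j1 = 0 & 0 < j2]) ->
  forall v, C v -> time_sqnorm P T v != 0%E ->
    exists eps0, 0 < eps0 <= 1 /\
      forall eps, 0 < `|eps| <= eps0 -> C (perturb ubar eps v) ->
        J ubar < J (perturb ubar eps v).
Proof.
move=> C J var v Cv v_neq0.
(* The disjunction lets [w] be both [v] and [- v]: the latter may leave [U] and so fail to be a
   control. *)
have local_min w : C w \/ C (fun t o => - w t o) -> time_sqnorm P T w != 0%E ->
    exists2 e : R, 0 < e & forall eps, 0 < eps <= 1 -> eps < e ->
      C (perturb ubar eps w) -> J ubar < J (perturb ubar eps w).
  move=> Cw /(var _ Cw)[j1 [j2 [_ J2 j10 j2_gt0]]].
  by rewrite j10 in J2; exact: second_variation_gt0_near J2 j2_gt0.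
have [e1 e1_gt0 He1] := local_min v (or_introl Cv) v_neq0.
have [||e2 e2_gt0 He2] := local_min (fun t o => - v t o).
- by right; under eq_fun do under eq_fun do rewrite opprK.
- by rewrite time_sqnormN.
pose m := Num.min e1 e2.
have m_gt0 : 0 < m by rewrite lt_min e1_gt0 e2_gt0.
(* Halving [m] turns the non-strict bound on [|eps|] into the strict ones by [e1] and [e2]; the cap
   1 keeps [|eps|] in the range of the variations. *)
exists (Num.min 1 (m / 2)); split.
  by rewrite lt_min ltr01 divr_gt0//= ge_min lexx.
move=> eps /andP[eps_gt0]; rewrite le_min => /andP[eps_le1 eps_le] Ceps.
have : `|eps| < m by rewrite (le_lt_trans eps_le)// gtr_pMr// invf_lt1// ltr1n.
rewrite lt_min => /andP[lt1 lt2].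
have [eps_ge0|eps_lt0] := leP 0 eps.
  rewrite ger0_norm// in eps_gt0 eps_le1 lt1.
  by apply: He1 => //; rewrite eps_gt0.
rewrite ltr0_norm// in eps_gt0 eps_le1 lt2.
(* Here [- eps] is a positive step along [- v] that reaches the same control. *)
rewrite -perturbN; apply: He2 => //; first by rewrite eps_gt0.
by rewrite perturbN.
Qed.
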